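(* Fix $p\in(0,1)$ and put $q=1-p$. Let $T_n$ be the completion time of the one-set clumsy coupon collector on $n$ types started from the empty collection. Then $pq^nT_n\Rightarrow\mathrm{Exp}(1)$ as $n\to\infty$.
   Context: One-set clumsy coupon collector: the state is $X(t)=(X_1(t),\dots,X_n(t))\in\{0,1\}^n$ ($X_i(t)=1$ meaning type $i$ is present), with $X(0)=(0,\dots,0)$. At each step one type $i$ is chosen uniformly from $[n]$, independently of the past, and $X_i$ is set to $1$ with probability $q$ and to $0$ with probability $p$ (independently); other coordinates are unchanged. $T_n=\inf\{t\ge0:X(t)=(1,\dots,1)\}$. $\mathrm{Exp}(1)$ is the exponential law with mean 1. *)

(* Defs.v *)
From HB Require Import structures.
From mathcomp Require Import all_boot all_order all_algebra.
From mathcomp Require Import all_classical all_reals all_analysis.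
Set Implicit Arguments. Unset Strict Implicit. Unset Printing Implicit Defensive.
Import Order.TTheory GRing.Theory Num.Theory.
Local Open Scope ring_scope.

Definition ccstate (n : nat) := {ffun 'I_n -> bool}.

Definition cc_empty (n : nat) : ccstate n := [ffun => false].
Definition cc_full (n : nat) : ccstate n := [ffun => true].

(* One step driven by the randomness c = (chosen type i, coin):
   coin = true  (probability q) : X_i := 1,
   coin = false (probability p) : X_i := 0; other coordinates unchanged. *)
Definition cc_step (n : nat) (x : ccstate n) (c : 'I_n * bool) : ccstate n :=
  [ffun j => if j == c.1 then c.2 else x j].

Definition cc_noise (n t : nat) := {ffun 'I_t -> 'I_n * bool}.

Definition cc_state_at (n t : nat) (w : cc_noise n t) (k : nat) : ccstate n :=
  foldl (@cc_step n) (cc_empty n) (take k [seq w i | i <- enum 'I_t]).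

(* Probability weight of a noise sequence: each step the type is uniform on
   [n] (prob 1/n) and independently the coin is true w.p. q = 1 - p. *)
Definition cc_weight {R : realType} (p : R) (n t : nat) (w : cc_noise n t) : R :=
  \prod_(i < t) (n%:R^-1 * (if (w i).2 then 1 - p else p)).

(* P( p q^n T_n <= x ), where T_n = inf {k : X(k) = (1,...,1)}.
   Since p q^n T_n <= x forces T_n <= N := truncn (x / (p q^n)), this event
   is determined by the first N steps. *)
Definition cc_scaled_cdf {R : realType} (p : R) (n : nat) (x : R) : R :=
  let c := p * (1 - p) ^+ n in
  let N := Num.truncn (x / c) in
  \sum_(w : cc_noise n N)
     cc_weight p w *
     (if [exists k : 'I_N.+1, (c * (k : nat)%:R <= x) && (cc_state_at w k == cc_full n)]
      then 1 else 0).

Definition exp1_cdf {R : realType} (x : R) : R :=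
  if x < 0 then 0 else 1 - expR (- x).

(* Main.v *)
Require Import Defs.
From HB Require Import structures.
From mathcomp Require Import all_boot all_order all_algebra.
From mathcomp Require Import all_classical all_reals all_analysis.
From mathcomp Require Import ring lra.
Import Order.TTheory GRing.Theory Num.Theory.
Import numFieldNormedType.Exports.
Local Open Scope classical_set_scope.
Local Open Scope ring_scope.

(** Let [u t x] be the probability that the chain started at [x] avoids the
full state [a] up to time [t], and [g t] its average under the stationary law
[pi], a product of Bernoulli laws, with [pi a = q^n]. Stationarity gives
[g (t+1) = g t - pi a * E u t (X_1)], the chain being started at [a]; it leaves
[a] in one step with probability [p]. If [u t] is uniformly within [eta] of
[g t] off [a], then [g (t+1)] is within [p q^n eta] of [(1 - p q^n) g t], so
[g], and hence [u], is uniformly close to [(1 - p q^n)^t]. The closeness of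
[u t x] and [g t] is obtained by letting the chain run for [s = n^2] steps:
- two copies driven by the same noise contract the mean Hamming distance by
  [1 - 1/n] at each step, so [s] steps forget the starting point;
- for [0 < r < 1], [r ^ (number of missing types)] is a supermartingale up to
  an exponentially small error, so from any state other than [a] the state [a]
  is reached within [s] steps with probability at most [r + o(1)]. *)

(** * Avoiding a state in a finite chain driven by independent noise *)

Section DrivenChain.
Context {R : realFieldType} {S C : finType}.
Variables (mu : C -> R) (step : S -> C -> S) (a : S).
Hypotheses (mu_ge0 : forall c, 0 <= mu c) (mu_sum : \sum_c mu c = 1).

Definition avg (f : S -> R) (x : S) : R := \sum_c mu c * f (step x c).

(** This is [u t x], computed by conditioning on the first step. Time 0 counts as a visit, so the
    value at [a] is 0. *)
Fixpoint surv (t : nat) (x : S) : R :=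
  if x == a then 0 else if t is t'.+1 then avg (surv t') x else 1.

Lemma ler_avg f g x : (forall y, f y <= g y) -> avg f x <= avg g x.
Proof. by move=> fg; apply: ler_sum => c _; apply: ler_wpM2l. Qed.

Lemma avg_affine f k l x : avg (fun y => k * f y + l) x = k * avg f x + l.
Proof.
rewrite /avg mulr_sumr -[l in RHS]mul1r -mu_sum mulr_suml -big_split /=.
by apply: eq_bigr => c _; rewrite mulrDr mulrCA.
Qed.

Lemma avgD f g x : avg (fun y => f y + g y) x = avg f x + avg g x.
Proof. by rewrite -big_split; apply: eq_bigr => c _; rewrite mulrDr. Qed.

Lemma surv_hit t : surv t a = 0. Proof. by case: t => /= [|t]; rewrite eqxx. Qed.

Lemma surv0 x : x != a -> surv 0 x = 1. Proof. by move=> /= /negPf->. Qed.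

Lemma survS t x : x != a -> surv t.+1 x = avg (surv t) x.
Proof. by move=> /= /negPf->. Qed.

Lemma surv_ge0 t x : 0 <= surv t x.
Proof.
elim: t x => [|t IH] x /=; case: ifP => // _.
by apply: sumr_ge0 => c _; apply: mulr_ge0.
Qed.

Lemma surv_le1 t x : surv t x <= 1.
Proof.
elim: t x => [|t IH] x /=; case: ifP => // _.
rewrite -mu_sum; apply: ler_sum => c _.
by rewrite -[leRHS]mulr1; apply: ler_wpM2l.
Qed.

Lemma survS_le t x : surv t.+1 x <= surv t x.
Proof.
elim: t x => [|t IH] x; have [->|xa] := eqVneq x a; rewrite ?surv_hit //.
  by rewrite surv0 // surv_le1.
by rewrite !(survS _ _ xa); apply: ler_avg.
Qed.

Lemma surv_anti s t x : (s <= t)%N -> surv t x <= surv s x.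
Proof.
move/subnK <-; elim: (t - s)%N => // k IH; rewrite addSn.
exact: le_trans (survS_le _ _) IH.
Qed.

(** The right side lets the first [s] steps run freely and forbids [a] only from time [s] on, a
    weaker constraint. *)
Lemma surv_le_iter s m x : surv (s + m) x <= iter s avg (surv m) x.
Proof.
elim: s x => // s IH x; rewrite addSn iterS.
have [->|xa] := eqVneq x a; last by rewrite survS //; apply: ler_avg.
rewrite surv_hit; apply: sumr_ge0 => c _; apply: mulr_ge0 => //.
exact: le_trans (surv_ge0 _ _) (IH _).
Qed.

Lemma iter_avg_le f s l x : (forall y, f y <= l) -> iter s avg f x <= l.
Proof.
move=> fl; elim: s x => // s IH x; rewrite iterS.
apply: (le_trans (ler_avg _ (fun=> 0 * 0 + l) _ _)).
  by move=> y; rewrite mulr0 add0r.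
by rewrite avg_affine mul0r add0r.
Qed.

(** Union bound: a path that avoids [a] from time [s] on either avoids it throughout or has met it
    by time [s]. *)
Lemma iter_le_surv s m x :
  iter s avg (surv m) x <= surv (s + m) x + (1 - surv s x).
Proof.
elim: s x => [|s IH] x.
  by rewrite lerDl subr_ge0; apply: surv_le1.
have [->|xa] := eqVneq x a.
  by rewrite !surv_hit subr0 add0r; apply: iter_avg_le => y; apply: surv_le1.
rewrite addSn !(survS _ _ xa) iterS.
apply: (le_trans (ler_avg _ _ _ IH)); rewrite avgD lerD2l.
rewrite [leRHS](_ : _ = -1 * avg (surv s) x + 1); last by ring.
by rewrite -avg_affine; apply: ler_avg => y; rewrite mulN1r addrC.
Qed.

(** Optional stopping in first-step form: stopped at [a], [phi] gains at most [kappa] per step on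
    average, and it is at least 1 on arrival. *)
Lemma hit_le_lyapunov (phi : S -> R) (kappa : R) s x :
    (forall y, 0 <= phi y) -> 1 <= phi a -> 0 <= kappa ->
    (forall y, y != a -> avg phi y <= phi y + kappa) ->
  1 - surv s x <= phi x + s%:R * kappa.
Proof.
move=> phi0 phia k0 phiS; elim: s x => [|s IH] x;
    have [->|xa] := eqVneq x a; rewrite ?surv_hit.
- by rewrite subr0 mul0r addr0.
- by rewrite surv0 // subrr mul0r addr0.
- by rewrite subr0 (le_trans phia) // lerDl mulr_ge0.
rewrite survS //.
have -> : 1 - avg (surv s) x = -1 * avg (surv s) x + 1 by ring.
rewrite -avg_affine.
apply: (le_trans (ler_avg _ (fun y => 1 * phi y + s%:R * kappa) _ _)).
  by move=> y; rewrite mulN1r mul1r addrC.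
rewrite avg_affine mul1r -natr1 mulrDl mul1r.
by have := phiS x xa; lra.
Qed.

(** Synchronous coupling: both starting points are moved by the same noise [c]. *)
Lemma iter_avg_contract (d : S -> S -> R) theta (f : S -> R) s x y :
    (forall x y, `|f x - f y| <= d x y) ->
    (forall x y, \sum_c mu c * d (step x c) (step y c) <= theta * d x y) ->
    0 <= theta ->
  `|iter s avg f x - iter s avg f y| <= theta ^+ s * d x y.
Proof.
move=> fd dS th0; elim: s x y => [|s IH] x y; first by rewrite expr0 mul1r.
rewrite !iterS /avg -sumrB (le_trans (ler_norm_sum _ _ _)) //.
rewrite exprSr -mulrA.
apply: (@le_trans _ _ (\sum_c theta ^+ s * (mu c * d (step x c) (step y c)))).
  apply: ler_sum => c _; rewrite -mulrBr normrM ger0_norm // mulrCA.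
  exact: ler_wpM2l.
by rewrite -mulr_sumr; apply: ler_wpM2l; rewrite ?exprn_ge0.
Qed.

(** * Stationary start and the geometric approximation *)

Variable pi : S -> R.
Hypotheses (pi_ge0 : forall x, 0 <= pi x) (pi_sum : \sum_x pi x = 1).
Hypothesis pi_inv : forall f, \sum_x pi x * avg f x = \sum_x pi x * f x.

Definition survpi t : R := \sum_x pi x * surv t x.

Lemma survpi0 : survpi 0 = 1 - pi a.
Proof.
rewrite /survpi (bigD1 a) //= eqxx mulr0 add0r -[in RHS]pi_sum.
rewrite [in RHS](bigD1 a) //=.
by rewrite addrAC subrr add0r; apply: eq_bigr => x /negPf->; rewrite mulr1.
Qed.

(* By stationarity, the first visit to [a] occurs at time t+1 with the same
   probability as: start at [a], then avoid it during the next t+1 steps. *)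
Lemma survpiS t : survpi t.+1 = survpi t - pi a * avg (surv t) a.
Proof.
rewrite {2}/survpi -pi_inv [in RHS](bigD1 a) //= /survpi (bigD1 a) //=.
rewrite eqxx mulr0 add0r [RHS]addrAC subrr add0r.
by apply: eq_bigr => x /negPf->.
Qed.

Lemma avg_surv01 t x : 0 <= avg (surv t) x <= 1.
Proof.
apply/andP; split.
  by apply: sumr_ge0 => c _; rewrite mulr_ge0 ?surv_ge0.
exact: (iter_avg_le _ 1%N _ _ (surv_le1 t)).
Qed.

Lemma survpi_drop s t : survpi t - s%:R * pi a <= survpi (s + t) <= survpi t.
Proof.
elim: s => [|s IH]; first by rewrite mul0r subr0 lexx.
rewrite addSn survpiS -natr1 mulrDl mul1r.
have /andP[h0 h1] := avg_surv01 (s + t)%N a.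
have := mulr_ge0 (pi_ge0 a) h0; have := ler_wpM2l (pi_ge0 a) h1.
by move: IH; lra.
Qed.

Definition leave : R := \sum_(c | step a c != a) mu c.

Section Geometric.
Variables (d : S -> S -> R) (theta D rho : R) (s : nat).
Hypotheses (d_ge1 : forall x y, x != y -> 1 <= d x y)
  (d_ge0 : forall x y, 0 <= d x y) (d_le : forall x y, d x y <= D)
  (d_step : forall x y,
     \sum_c mu c * d (step x c) (step y c) <= theta * d x y)
  (theta_ge0 : 0 <= theta) (rho_ge0 : 0 <= rho)
  (hit_le : forall x, x != a -> 1 - surv s x <= rho).

(** The three terms pay for the coupling, for a visit to [a] within [s] steps, and for the decrease
    of [survpi] over [s] steps together with its initial deficit [pi a]. *)
Let eta := theta ^+ s * D + rho + s.+1%:R * pi a.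

Lemma iter_avg_survpi m x :
  `|iter s avg (surv m) x - survpi m| <= theta ^+ s * D.
Proof.
have -> : survpi m = \sum_y pi y * iter s avg (surv m) y.
  by elim: s => // k ->; rewrite -pi_inv.
rewrite -[iter s avg _ x]mul1r -pi_sum mulr_suml -sumrB.
rewrite (le_trans (ler_norm_sum _ _ _)) // -[leRHS]mul1r -pi_sum mulr_suml.
apply: ler_sum => y _; rewrite -mulrBr normrM ger0_norm //.
apply: ler_wpM2l => //.
apply: le_trans (ler_wpM2l (exprn_ge0 s theta_ge0) (d_le x y)).
apply: iter_avg_contract => // {}x {}y.
(* [surv m] takes values in [0,1] and [d] is at least 1 off the diagonal, so [surv m] is
   1-Lipschitz. *)
have [->|/d_ge1] := eqVneq x y; first by rewrite subrr normr0.
apply: le_trans; rewrite ler_norml.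
have := surv_ge0 m x; have := surv_le1 m x.
have := surv_ge0 m y; have := surv_le1 m y; lra.
Qed.

Lemma surv_survpi t x : x != a -> `|surv t x - survpi t| <= eta.
Proof.
move=> xa; rewrite /eta; have hx := hit_le x xa.
have pa0 := pi_ge0 a.
have tD0 : 0 <= theta ^+ s * D.
  by rewrite mulr_ge0 ?exprn_ge0 // (le_trans _ (d_le x x)).
have [st|ts] := leqP s t.
  have := iter_avg_survpi (t - s) x; have := survpi_drop s (t - s)%N.
  have := surv_le_iter s (t - s) x; have := iter_le_surv s (t - s) x.
  rewrite subnKC // -natr1 mulrDl mul1r !ler_norml.
  by move=> h1 h2 h3 h4; move: hx; lra.
(* Before time [s] there is no room for mixing, but both quantities are still close to 1. *)
have := survpi_drop t 0; rewrite addn0 survpi0.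
have := surv_anti _ _ x (ltnW ts); have := surv_le1 t x.
have : t.+1%:R * pi a <= s.+1%:R * pi a.
  by apply: ler_wpM2r => //; rewrite ler_nat ltnW.
rewrite -!natr1 !mulrDl !mul1r ler_norml.
have := mulr_ge0 (ler0n R t) pa0.
by move=> h1 h2 h3 h4; move: hx; lra.
Qed.

(** Noise that keeps the chain at [a] contributes 0; all other noise lands off [a], where
    [surv_survpi] applies. *)
Lemma avg_surv_leave t : `|avg (surv t) a - leave * survpi t| <= leave * eta.
Proof.
have -> : avg (surv t) a =
    \sum_(c | step a c != a) mu c * surv t (step a c).
  rewrite /avg [LHS](bigID (fun c => step a c != a)) /=.
  rewrite [X in _ + X]big1 ?addr0 // => c.
  by rewrite negbK => /eqP->; rewrite surv_hit mulr0.
rewrite /leave !mulr_suml -sumrB (le_trans (ler_norm_sum _ _ _)) //.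
apply: ler_sum => c ca; rewrite -mulrBr normrM ger0_norm //.
exact/ler_wpM2l/surv_survpi.
Qed.

Lemma survpi_geometric t :
  `|survpi t - (1 - pi a * leave) ^+ t| <= eta + pi a.
Proof.
have pa0 := pi_ge0 a.
have l0 : 0 <= leave by apply: sumr_ge0.
have l1 : leave <= 1.
  by rewrite -mu_sum /leave [leRHS](bigID (fun c => step a c != a)) /= lerDl sumr_ge0.
have pa1 : pi a <= 1 by rewrite -pi_sum (bigD1 a) //= lerDl sumr_ge0.
set lam := pi a * leave.
have lam1 : 0 <= 1 - lam by rewrite subr_ge0 mulr_ile1.
have lam0 : 0 <= lam by rewrite mulr_ge0.
have tD0 : 0 <= theta ^+ s * D.
  by rewrite mulr_ge0 ?exprn_ge0 // (le_trans _ (d_le a a)).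
elim: t => [|t IH].
  rewrite survpi0 expr0 addrAC subrr add0r normrN ger0_norm // lerDr /eta.
  by apply: addr_ge0; [exact: addr_ge0|exact: mulr_ge0].
(* The old error shrinks by [1 - lam] and the new one is at most [lam * eta], so the bound
   [eta + pi a] is preserved. *)
have -> : survpi t.+1 - (1 - lam) ^+ t.+1 = (survpi t - (1 - lam) ^+ t) *
    (1 - lam) - pi a * (avg (surv t) a - leave * survpi t).
  by rewrite survpiS exprSr /lam; ring.
rewrite (le_trans (ler_normB _ _)) // !normrM (ger0_norm lam1) (ger0_norm pa0).
have := ler_wpM2l pa0 (avg_surv_leave t); have := ler_wpM2r lam1 IH.
rewrite mulrA -/lam.
have := mulr_ge0 lam0 pa0.
set u := `|_ - _|; set v := `|_ - _|; move=> h0 h1 h2.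
by apply: (le_trans (lerD h1 h2)); rewrite mulrBr mulr1; lra.
Qed.

Lemma surv_geometric t x : x != a ->
  `|surv t x - (1 - pi a * leave) ^+ t| <=
  2 * (theta ^+ s * D + rho + s.+2%:R * pi a).
Proof.
move=> xa; rewrite (le_trans (ler_distD (survpi t) _ _)) //.
rewrite (le_trans (lerD (surv_survpi t x xa) (survpi_geometric t))) //.
by rewrite /eta -[s.+2%:R]natr1 mulrDl; have := pi_ge0 a; lra.
Qed.
End Geometric.

(** * Sums over noise sequences *)

Lemma sum_ffunS t (F : {ffun 'I_t.+1 -> C} -> R) :
  \sum_w F w = \sum_c \sum_(w : {ffun 'I_t -> C})
    F [ffun i => if unlift ord0 i is Some j then w j else c].
Proof.
rewrite pair_big /=.
pose h (cw : C * {ffun 'I_t -> C}) : {ffun 'I_t.+1 -> C} :=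
  [ffun i => if unlift ord0 i is Some j then cw.2 j else cw.1].
pose k (w : {ffun 'I_t.+1 -> C}) := (w ord0, [ffun j => w (lift ord0 j)]).
rewrite (reindex h) //=; exists k => [[c w] _|w _].
  rewrite /k /h ffunE unlift_none; congr pair.
  by apply/ffunP => j; rewrite !ffunE liftK.
apply/ffunP => i; rewrite ffunE.
by case: unliftP => [j ->|->] //=; rewrite ffunE.
Qed.

(** Splitting off the first noise value turns the explicit path sum into the recursion that defines
    [surv]. *)
Lemma sum_hit t x :
  \sum_(w : {ffun 'I_t -> C}) (\prod_(i < t) mu (w i)) *
    (a \in x :: scanl step x [seq w i | i <- enum 'I_t])%:R = 1 - surv t x.
Proof.
elim: t x => [|t IH] x.
  have f0 : {ffun 'I_0 -> C} by apply: ffun0; rewrite card_ord.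
  rewrite (big_pred1 f0) => [|w]; last by apply/esym/eqP/ffunP => -[].
  rewrite big_ord0 mul1r; have -> : enum 'I_0 = [::].
    by apply: size0nil; rewrite size_enum_ord.
  by rewrite /= inE eq_sym; case: eqP => _ /=; rewrite ?subr0 ?subrr.
rewrite sum_ffunS.
have -> : 1 - surv t.+1 x =
    \sum_c mu c * (if x == a then 1 else 1 - surv t (step x c)).
  have [->|xa] := eqVneq x a.
    by rewrite surv_hit subr0 -[LHS]mu_sum; apply: eq_bigr => c _; rewrite mulr1.
  rewrite survS // -[X in X - _ = _]mu_sum -sumrB.
  by apply: eq_bigr => c _; rewrite mulrBr mulr1.
apply: eq_bigr => c _; pose e := enum 'I_t.
transitivity (mu c * \sum_(w : {ffun 'I_t -> C}) (\prod_(i < t) mu (w i)) *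
    (a \in x :: step x c :: scanl step (step x c) [seq w i | i <- e])%:R).
  rewrite mulr_sumr; apply: eq_bigr => w _.
  rewrite big_ord_recl ffunE unlift_none mulrA; congr (_ * _ * _%:R).
    by apply: eq_bigr => i _; rewrite ffunE liftK.
  rewrite enum_ordSl /= ffunE unlift_none -map_comp; congr (nat_of_bool (a \in _ :: _ :: scanl _ _ _)).
  by apply: eq_map => i /=; rewrite ffunE liftK.
congr (_ * _); have [->|xa] := eqVneq x a; last first.
  by rewrite -IH; apply: eq_bigr => w _; rewrite inE eq_sym (negPf xa).
transitivity (\sum_(w : {ffun 'I_t -> C}) \prod_(i < t) mu (w i)).
  by apply: eq_bigr => w _; rewrite mem_head mulr1.
rewrite -(bigA_distr_bigA (fun _ : 'I_t => mu)) /=.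
by rewrite big1 // => i _; rewrite mu_sum.
Qed.
End DrivenChain.

(** * The collector: product stationary law and Hamming contraction *)

Section Collector.
Context {R : realType}.
Variables (p : R) (n : nat).
Hypotheses (p_gt0 : 0 < p) (p_lt1 : p < 1) (n_gt0 : (0 < n)%N).

Let q : R := 1 - p.
Let coin (b : bool) : R := if b then q else p.
Let mu (c : 'I_n * bool) : R := n%:R^-1 * coin c.2.
Let pi (x : ccstate n) : R := \prod_i coin (x i).
Let full : ccstate n := cc_full n.

Let q_gt0 : 0 < q. Proof. by rewrite subr_gt0. Qed.
Let n_neq0 : n%:R != 0 :> R. Proof. by rewrite pnatr_eq0 -lt0n. Qed.

Let coin_ge0 b : 0 <= coin b. Proof. by case: b; apply: ltW. Qed.
Let mu_ge0 c : 0 <= mu c. Proof. by rewrite mulr_ge0 ?invr_ge0. Qed.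

Let sum_noise (F : 'I_n -> bool -> R) :
  \sum_c mu c * F c.1 c.2 = n%:R^-1 * \sum_i (q * F i true + p * F i false).
Proof.
rewrite -(pair_bigA _ (fun i b => mu (i, b) * F i b)) mulr_sumr /=.
by apply: eq_bigr => i _; rewrite big_bool /mu /=; ring.
Qed.

Let mean_const (k : R) : n%:R^-1 * (\sum_(i < n) k) = k.
Proof. by rewrite sumr_const card_ord -[k *+ n]mulr_natl mulKf. Qed.

Let coin_mix (k : R) : q * k + p * k = k. Proof. by rewrite /q; ring. Qed.

Let mu_sum : \sum_c mu c = 1.
Proof.
under eq_bigr do rewrite -[mu _]mulr1.
by rewrite (sum_noise (fun _ _ => 1)) coin_mix mean_const.
Qed.

Let pi_ge0 x : 0 <= pi x. Proof. exact: prodr_ge0. Qed.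

Let pi_sum : \sum_x pi x = 1.
Proof.
rewrite -(bigA_distr_bigA (fun _ => coin)) /= big1 // => i _.
by rewrite big_bool /= /q subrK.
Qed.

Let pi_full : pi full = q ^+ n.
Proof.
rewrite -[n in RHS]card_ord -prodr_const.
by apply: eq_bigr => i _; rewrite ffunE.
Qed.

(* Resampling coordinate [i] preserves [pi]: swapping the old value of the
   coordinate with the fresh coin is a weight-preserving involution. *)
Let pi_resample (f : ccstate n -> R) i :
  \sum_x pi x * (q * f (cc_step x (i, true)) + p * f (cc_step x (i, false))) =
  \sum_x pi x * f x.
Proof.
transitivity (\sum_x \sum_b pi x * coin b * f (cc_step x (i, b))).
  by apply: eq_bigr => x _; rewrite big_bool /= mulrDr !mulrA.
pose h (u : ccstate n * bool) := (cc_step u.1 (i, u.2), u.1 i).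
have hK : involutive h.
  case=> x b; rewrite /h /=; congr pair; last by rewrite ffunE eqxx.
  by apply/ffunP => j; rewrite !ffunE /=; case: eqP => // ->.
rewrite pair_bigA /= (reindex_inj (inv_inj hK)) /=.
transitivity (\sum_(u : ccstate n * bool) pi u.1 * coin u.2 * f u.1).
  apply: eq_bigr => -[x b] _ /=; congr (_ * f _); last exact: (congr1 fst (hK (x, b))).
  rewrite /pi (bigD1 i) //= [in RHS](bigD1 i) //= ffunE eqxx mulrAC [RHS]mulrAC.
  rewrite [coin b * _]mulrC; congr (_ * _); apply: eq_bigr => j /negPf ji.
  by rewrite ffunE /= ji.
rewrite -(pair_bigA _ (fun x b => pi x * coin b * f x)) /=.
by apply: eq_bigr => x _; rewrite big_bool /= /q; ring.
Qed.

(** A step resamples a uniformly chosen coordinate, so [pi_resample] is averaged over [i]. *)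
Let pi_inv f : \sum_x pi x * avg mu (@cc_step n) f x = \sum_x pi x * f x.
Proof.
rewrite -[RHS]mean_const.
under [in RHS]eq_bigr => i _ do rewrite -(pi_resample f i).
rewrite exchange_big mulr_sumr; apply: eq_bigr => x _ /=.
rewrite -mulr_sumr mulrCA /avg -(sum_noise (fun i b => f (cc_step x (i, b)))).
by congr (_ * _); apply: eq_bigr => -[].
Qed.

Let leave_full : leave mu (@cc_step n) full = p.
Proof.
rewrite /leave big_mkcond /= -[RHS]mean_const.
under eq_bigr do rewrite -[if _ then _ else _]mulr1.
transitivity (\sum_(c : 'I_n * bool) mu c * (~~ c.2)%:R).
  apply: eq_bigr => -[i b] _ /=; rewrite mulr1; case: ifPn; case: b => //=.
  - by case/eqP; apply/ffunP => j; rewrite !ffunE; case: ifP.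
  - by rewrite mulr1.
  - by rewrite mulr0.
  - by rewrite negbK => /eqP/ffunP/(_ i); rewrite !ffunE eqxx.
rewrite (sum_noise (fun _ b => (~~ b)%:R)) /=.
by congr (_ * _); apply: eq_bigr => i _; rewrite mulr0 mulr1 add0r.
Qed.

Let hamming (x y : ccstate n) : R := \sum_j (x j != y j)%:R.

(** The chosen coordinate agrees in both copies afterwards, so a disagreement at [j] survives
    exactly when another type is chosen. Equality in fact holds. *)
Let hamming_step x y :
  \sum_c mu c * hamming (cc_step x c) (cc_step y c)
    <= (1 - n%:R^-1) * hamming x y.
Proof.
rewrite le_eqVlt; apply/orP; left; apply/eqP.
under eq_bigr do rewrite mulr_sumr.
rewrite exchange_big mulr_sumr; apply: eq_bigr => j _.
pose e : R := (x j != y j)%:R.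
transitivity (\sum_c mu c * ((c.1 != j)%:R * e)).
  apply: eq_bigr => -[i b] _; rewrite !ffunE /= [j == i]eq_sym.
  by case: (i == j); rewrite /= ?eqxx ?mul0r ?mul1r.
rewrite (sum_noise (fun i _ => (i != j)%:R * e)).
under eq_bigr do rewrite coin_mix.
rewrite -mulr_suml mulrA; congr (_ * _).
rewrite -[X in X - _](mean_const 1) -[X in _ - X]mulr1 -mulrBr; congr (_ * _).
rewrite [in RHS](bigD1 j) //= addrAC subrr add0r (bigD1 j) //= eqxx add0r.
by apply: eq_bigr => i ->.
Qed.

Let hamming_ge0 x y : 0 <= hamming x y. Proof. exact: sumr_ge0. Qed.

Let hamming_ge1 x y : x != y -> 1 <= hamming x y.
Proof.
move=> /eqP xy; have [j xyj|xyE] := pickP (fun j => x j != y j); last first.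
  by case: xy; apply/ffunP => j; apply/eqP/negbFE; rewrite xyE.
by rewrite /hamming (bigD1 j) //= xyj lerDl sumr_ge0.
Qed.

Let hamming_le x y : hamming x y <= n%:R.
Proof.
rewrite -[n in leRHS]card_ord -sum1_card natr_sum.
by apply: ler_sum => j _; rewrite lern1 leq_b1.
Qed.

(** * The Lyapunov function counting missing types *)

Section Lyapunov.
Variable r : R.
Hypotheses (r_gt0 : 0 < r) (r_lt1 : r < 1).
(** The proportion of missing types at which the drift of [phi] changes sign; [z ^+ n] is then the
    value of [phi] at the threshold. *)
Let beta : R := p * r / (q + p * r).
Let z : R := r `^ beta.

Let missing (x : ccstate n) : nat := #|[pred i | ~~ x i]|.
Let phi x : R := r ^+ missing x.

Let phiE x : phi x = \prod_i (if x i then 1 else r).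
Proof.
rewrite /phi /missing -prodr_const big_mkcond /=.
by apply: eq_bigr => i _; rewrite inE; case: (x i).
Qed.

Let phi_step x i : q * phi (cc_step x (i, true)) + p * phi (cc_step x (i, false))
  = phi x * (q + p * r + (~~ x i)%:R * ((1 - r) * (q + p * r) / r)).
Proof.
have E b : phi (cc_step x (i, b)) =
    (if b then 1 else r) * \prod_(j < n | j != i) (if x j then 1 else r).
  rewrite phiE (bigD1 i) //= ffunE eqxx /=; congr (_ * _).
  by apply: eq_bigr => j /negPf ji; rewrite ffunE /= ji.
rewrite !E phiE [in RHS](bigD1 i) //= /q.
by case: (x i) => /=; field; rewrite gt_eqF.
Qed.

Let avg_phi x : avg mu (@cc_step n) phi x = phi x *
  (q + p * r + n%:R^-1 * (missing x)%:R * ((1 - r) * (q + p * r) / r)).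
Proof.
transitivity (\sum_c mu c * phi (cc_step x (c.1, c.2))).
  by apply: eq_bigr => -[].
rewrite (sum_noise (fun i b => phi (cc_step x (i, b)))).
under eq_bigr do rewrite phi_step.
rewrite -mulr_sumr mulrCA big_split /= mulrDr mean_const -mulr_suml mulrA.
congr (_ * (_ + _ * _ * _)); rewrite /missing -sum1_card natr_sum [RHS]big_mkcond /=.
by apply: eq_bigr => i _; rewrite inE; case: (x i).
Qed.

Let mix_gt0 : 0 < q + p * r. Proof. by rewrite addr_gt0 // mulr_gt0. Qed.

Let phi_le x : beta * n%:R <= (missing x)%:R -> phi x <= z ^+ n.
Proof.
move=> h; rewrite /phi /z -!powR_mulrn ?powR_ge0 ?(ltW r_gt0) // -powRrM.
by apply: ger_powR => //; rewrite r_gt0 ltW.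
Qed.

Let phi_drift x : avg mu (@cc_step n) phi x <= phi x + r^-1 * z ^+ n.
Proof.
have phi0 : 0 <= phi x by rewrite exprn_ge0 // ltW.
have z0 : 0 <= z ^+ n by rewrite exprn_ge0 // powR_ge0.
have r1 : 0 <= r^-1 by rewrite invr_ge0 ltW.
set j : R := (missing x)%:R.
have E : avg mu (@cc_step n) phi x = phi x +
    phi x * (r^-1 * ((1 - r) * (q + p * r) * (n%:R^-1 * j - beta))).
  rewrite avg_phi -/j /beta.
  have := lt0r_neq0 r_gt0; have := lt0r_neq0 mix_gt0; rewrite /q => h1 h2.
  by field; rewrite h1 h2 n_neq0.
rewrite E lerD2l mulrCA; apply: ler_wpM2l => //.
(* Below the threshold the drift is nonpositive. Above it the drift is at most [r^-1 * phi x], and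
   [phi x] is already below [z ^+ n]. *)
have [small|big] := leP (n%:R^-1 * j) beta.
  apply: le_trans z0; rewrite mulr_ge0_le0 // mulr_ge0_le0 //; last by lra.
  by rewrite mulr_ge0 // ?ltW // subr_gt0.
apply: (@le_trans _ _ (phi x)); last first.
  apply: phi_le; rewrite -ler_pdivlMr ?ltr0n // mulrC; exact: ltW.
rewrite -[leRHS]mulr1; apply: ler_wpM2l => //.
have m1 : q + p * r <= 1.
  have : p * r <= p by rewrite ger_pMr // ltW.
  by rewrite /q; lra.
have b0 : 0 <= beta by rewrite /beta divr_ge0 ?ltW // mulr_gt0.
have j1 : n%:R^-1 * j <= 1.
  rewrite mulrC ler_pdivrMr ?ltr0n // mul1r ler_nat.
  by rewrite -[n in leqRHS]card_ord max_card.
have := ltW mix_gt0; move: r_gt0 r_lt1 => ? ? ?.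
rewrite mulr_ile1 ?mulr_ge0 ?mulr_ile1 //; lra.
Qed.

Let phi_full : phi full = 1.
Proof. by rewrite phiE big1 // => i _; rewrite ffunE. Qed.

Let phi_le_r x : x != full -> phi x <= r.
Proof.
move=> xf; have m0 : (0 < missing x)%N.
  apply/card_gt0P; rewrite /=.
  have [i xi|xE] := pickP (fun i => ~~ x i); first by exists i.
  case/eqP: xf; apply/ffunP => i; rewrite ffunE.
  by apply/negbFE; rewrite xE.
by rewrite /phi -[leRHS]expr1; apply: ler_wiXn2l => //; apply: ltW.
Qed.

(** Instance of [surv_geometric] with rate [1 - n%:R^-1] and diameter [n]; the hitting term is the
    initial bound [phi x <= r] off [full] plus [s] drift errors. *)
Lemma cc_surv_geometric s t :
  `|surv mu (@cc_step n) full t (cc_empty n) - (1 - p * q ^+ n) ^+ t| <=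
  2 * ((1 - n%:R^-1) ^+ s * n%:R + (r + s%:R * (r^-1 * z ^+ n))
       + s.+2%:R * q ^+ n).
Proof.
have z0 : 0 <= r^-1 * z ^+ n.
  by rewrite mulr_ge0 ?invr_ge0 ?exprn_ge0 ?powR_ge0 // ltW.
rewrite [p * _]mulrC -[X in 1 - _ * X]leave_full -!pi_full.
apply: (@surv_geometric _ _ _ _ _ _ mu_ge0 mu_sum _ pi_ge0 pi_sum pi_inv
  hamming) => //.
- by rewrite subr_ge0 invf_le1 ?ltr0n // ler1n.
- by apply: addr_ge0; [exact: ltW|exact: mulr_ge0].
- move=> x xf; apply: (le_trans (@hit_le_lyapunov _ _ _ _ _ _ mu_ge0 mu_sum phi
    (r^-1 * z ^+ n) s x _ _ z0 _)).
  + by move=> y; rewrite exprn_ge0 // ltW.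
  + by rewrite phi_full.
  + by move=> y _; apply: phi_drift.
  + by rewrite lerD2r phi_le_r.
apply/eqP => /ffunP/(_ (Ordinal n_gt0)); by rewrite !ffunE.
Qed.
End Lyapunov.

(** Every [k] up to the truncated quotient meets the scaling constraint, so the event only says that
    the path visits [full]. *)
Lemma cc_scaled_cdf_surv x : 0 <= x ->
  cc_scaled_cdf p n x = 1 - surv mu (@cc_step n) full
    (Num.truncn (x / (p * (1 - p) ^+ n))) (cc_empty n).
Proof.
move=> x0; rewrite -sum_hit // /cc_scaled_cdf.
set c := p * _; set N := Num.truncn _.
have c0 : 0 < c by rewrite mulr_gt0 // exprn_gt0.
apply: eq_bigr => w _; congr (_ * _).
set s := [seq w i | i <- enum 'I_N].
have ss : size s = N by rewrite size_map size_enum_ord.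
rewrite (_ : [exists k, _] = (full \in cc_empty n :: scanl (@cc_step n) (cc_empty n) s)).
  by case: (_ \in _).
apply/existsP/(nthP full) => [[k /andP[_ /eqP kf]]|[k]].
  exists k; first by rewrite /= size_scanl ss.
  rewrite -[RHS]kf /cc_state_at -/s; case: k {kf} => -[|k] kN /=.
    by rewrite take0.
  by rewrite nth_scanl // ss.
rewrite /= size_scanl ss => kN kf; exists (Ordinal kN).
apply/andP; split.
  rewrite mulrC -ler_pdivlMr //.
  apply: (@le_trans _ _ N%:R); first by rewrite ler_nat -ltnS.
  by rewrite truncn_le divr_ge0 // ltW.
apply/eqP; rewrite -[RHS]kf /cc_state_at -/s /=.
case: k {kf} kN => [|k] kN /=; first by rewrite take0.
by rewrite nth_scanl // ss.
Qed.

Lemma cc_scaled_cdf_geometric r s x : 0 < r -> r < 1 -> 0 <= x ->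
  `|cc_scaled_cdf p n x -
    (1 - (1 - p * (1 - p) ^+ n) ^+ Num.truncn (x / (p * (1 - p) ^+ n)))| <=
  2 * ((1 - n%:R^-1) ^+ s * n%:R
       + (r + s%:R * (r^-1 * (r `^ (p * r / (1 - p + p * r))) ^+ n))
       + s.+2%:R * (1 - p) ^+ n).
Proof.
move=> r0 r1 x0; rewrite cc_scaled_cdf_surv //.
set u := surv _ _ _ _ _; set v := _ ^+ _.
have -> : 1 - u - (1 - v) = - (u - v) by ring.
by rewrite normrN; apply: cc_surv_geometric.
Qed.
End Collector.

(** * Limits of the main term and of the errors *)

Lemma sqr_geometric_cvg0 (R : realType) (z : R) : 0 < z -> z < 1 ->
  (fun n : nat => n%:R ^+ 2 * z ^+ n) @ \oo --> (0 : R).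
Proof.
(* With [z = w ^+ 3], two of the factors [w ^+ n] absorb [n%:R ^+ 2] and the third tends to 0. *)
move=> z0 z1; pose a := - ln z / 3.
have a0 : 0 < a by rewrite divr_gt0 // oppr_gt0 ln_lt0 // z0.
pose w := expR (- a).
have zE : z = w ^+ 3.
  by rewrite /w -expRM_natl /a; have -> : 3%:R * - (- ln z / 3) = ln z;
    [by field | rewrite lnK].
have nw (n : nat) : n%:R * w ^+ n <= a^-1.
  rewrite -ler_pdivlMr ?exprn_gt0 ?expR_gt0 // /w -exprVn -expRN opprK.
  rewrite -expRM_natl ler_pdivlMl //.
  by apply: le_trans (expR_ge1Dx _); rewrite mulrC; lra.
apply: (@squeeze_cvgr _ _ _ _ (fun=> 0) (fun n => a^-1 ^+ 2 * w ^+ n)).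
- apply: nearW => n; rewrite mulr_ge0 ?exprn_ge0 ?(ltW z0) //=.
  rewrite zE -exprM mulnC exprM.
  have -> : n%:R ^+ 2 * (w ^+ n) ^+ 3 = (n%:R * w ^+ n) ^+ 2 * w ^+ n by ring.
  apply: ler_wpM2r; first by rewrite exprn_ge0 // expR_ge0.
  apply: lerXn2r => //; rewrite nnegrE ?mulr_ge0 ?exprn_ge0 ?expR_ge0 //.
  by rewrite invr_ge0 ltW.
- exact: cvg_cst.
- rewrite -[0](mulr0 (a^-1 ^+ 2)); apply: cvgM; first exact: cvg_cst.
  by apply: cvg_expr; rewrite ger0_norm ?expR_ge0 // expR_lt1 oppr_lt0.
Qed.

(** Squeeze by [expR (- (l / (1 - l))) <= 1 - l <= expR (- l)], with the exponent between
    [x / l - 1] and [x / l]. *)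
Lemma expr_truncn_cvg (R : realType) (l : nat -> R) (x : R) : 0 <= x ->
    (forall n, 0 < l n < 1) -> l @ \oo --> (0 : R) ->
  (fun n => (1 - l n) ^+ Num.truncn (x / l n)) @ \oo --> expR (- x).
Proof.
move=> x0 l01 lcvg.
have expR_cvg (f : nat -> R) (a : R) :
    f @ \oo --> a -> (fun n => expR (f n)) @ \oo --> expR a.
  move=> fa; apply: (@continuous_cvg _ _ _ _ _ f (@expR R) a) => //.
  exact: continuous_expR.
apply: (@squeeze_cvgr _ _ _ _ (fun n => expR (- (x / (1 - l n))))
  (fun n => expR (l n - x))).
- apply: nearW => n; have /andP[l0 l1] := l01 n.
  have m0 : 0 < 1 - l n by rewrite subr_gt0.
  set N := Num.truncn _.
  have /andP[Nle Ngt] : N%:R <= x / l n < N.+1%:R.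
    by rewrite truncn_itv // divr_ge0 // ltW.
  move: Nle Ngt; rewrite ler_pdivlMr // ltr_pdivrMr // => Nle Ngt.
  apply/andP; split.
    apply: (@le_trans _ _ (expR (- (l n / (1 - l n))) ^+ N)).
      rewrite -expRM_natl ler_expR mulrN lerN2 mulrA.
      by apply: ler_wpM2r => //; rewrite invr_ge0 ltW.
    apply: lerXn2r; rewrite ?nnegrE ?expR_ge0 ?(ltW m0) //.
    rewrite expRN -[leRHS]invrK lef_pV2 ?posrE ?expR_gt0 ?invr_gt0 //.
    apply: le_trans (expR_ge1Dx _).
    by rewrite le_eqVlt; apply/orP; left; apply/eqP; field; rewrite gt_eqF.
  apply: (@le_trans _ _ (expR (- l n) ^+ N)).
    apply: lerXn2r; rewrite ?nnegrE ?expR_ge0 ?(ltW m0) //.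
    exact: expR_ge1Dx.
  rewrite -expRM_natl ler_expR.
  by move: Ngt; rewrite -natr1; lra.
- apply: expR_cvg.
  apply: cvgN; rewrite -[x in _ --> x]divr1 -[X in x / X]subr0.
  apply: cvgM; first exact: cvg_cst.
  apply: cvgV; first by rewrite subr0.
  by apply: cvgB => //; exact: cvg_cst.
- apply: expR_cvg.
  rewrite -[X in _ --> X]add0r; apply: cvgB => //; exact: cvg_cst.
Qed.

(** Double limit: [n] goes to infinity with [r] fixed, and only then is [r] made small. *)
Lemma near_le_cvg0 (R : realType) (f : nat -> R) (g : R -> nat -> R) (k : R) :
    0 < k ->
    (forall r, 0 < r -> r < 1 -> \forall n \near \oo, `|f n| <= g r n) ->
    (forall r, 0 < r -> r < 1 -> g r @ \oo --> k * r) ->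
  f @ \oo --> (0 : R).
Proof.
move=> k0 fg gc; apply/cvgr0Pnorm_le => e e0.
(* This choice gives [r < 1] and [k * r < e] at once. *)
pose r := e / (k + e + k * e).
have d0 : 0 < k + e + k * e by rewrite !addr_gt0 // mulr_gt0.
have r0 : 0 < r by rewrite divr_gt0.
have r1 : r < 1 by rewrite ltr_pdivrMr // mul1r; have := mulr_gt0 k0 e0; lra.
have kre : k * r < e.
  rewrite /r mulrA ltr_pdivrMr // mulrC ltr_pM2l //.
  by have := mulr_gt0 k0 e0; lra.
near=> n; apply: (@le_trans _ _ (g r n)); first by near: n; apply: fg.
by near: n; apply: cvgr_le kre; apply: gc.
Unshelve. all: by end_near. Qed.

Lemma cc_mixing_cvg0 (R : realType) :
  (fun n : nat => (1 - n%:R^-1) ^+ (n ^ 2) * n%:R) @ \oo --> (0 : R).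
Proof.
apply: (@squeeze_cvgr _ _ _ _ (fun=> 0)
  (fun n : nat => n%:R ^+ 2 * expR (- 1) ^+ n)).
- near=> n; have n0 : 0 < n%:R :> R by rewrite ltr0n; near: n; exists 1%N.
  have n1 : 1 <= n%:R :> R by rewrite ler1n -(ltr0n R).
  have m0 : 0 <= 1 - n%:R^-1 :> R by rewrite subr_ge0 invf_le1.
  rewrite mulr_ge0 ?exprn_ge0 //= mulrC.
  apply: ler_pM; rewrite ?exprn_ge0 //; first by rewrite ler_eXnr.
  rewrite expnS expn1 exprM; apply: lerXn2r; rewrite ?nnegrE ?exprn_ge0 ?expR_ge0 //.
  (* Hence [(1 - n%:R^-1) ^+ n <= expR (- 1)], from [1 - y <= expR (- y)]. *)
  have -> : expR (- 1) = expR (- n%:R^-1) ^+ n :> R.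
    by rewrite -expRM_natl mulrN mulfV ?gt_eqF.
  apply: lerXn2r; rewrite ?nnegrE ?expR_ge0 //; exact: expR_ge1Dx.
- exact: cvg_cst.
- apply: sqr_geometric_cvg0; rewrite ?expR_gt0 // expR_lt1 oppr_lt0 //.
Unshelve. all: by end_near. Qed.

(* p q^n T_n => Exp(1): the distribution functions converge at every point
   (every real is a continuity point of the Exp(1) cdf). *)
Theorem mainTheorem3 (R : realType) (p : R) (hp0 : 0 < p) (hp1 : p < 1) :
  forall x : R, (fun n : nat => cc_scaled_cdf p n x) @ \oo --> exp1_cdf x.
Proof.
move=> x; rewrite /exp1_cdf; have q0 : 0 < 1 - p by rewrite subr_gt0.
have q1 : 1 - p < 1 by rewrite ltrBlDr ltrDl.
have c0 n : 0 < p * (1 - p) ^+ n by rewrite mulr_gt0 // exprn_gt0.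
case: ltP => x0.
  rewrite (_ : (fun n => _) = fun=> 0); first exact: cvg_cst.
  apply/funext => n; rewrite /cc_scaled_cdf big1 // => w _.
  case: existsP => [[k /andP[]]|]; last by rewrite mulr0.
  by rewrite leNgt (lt_le_trans x0) // mulr_ge0 // ltW.
have qcvg : (fun n => (1 - p) ^+ n) @ \oo --> 0.
  by apply: cvg_expr; rewrite ger0_norm // ltW.
apply: (@cvg_sub0 _ _ _ _ _ _ (fun n => 1 - (1 - p * (1 - p) ^+ n) ^+
    Num.truncn (x / (p * (1 - p) ^+ n)))); last first.
  apply: cvgB; first exact: cvg_cst.
  apply: expr_truncn_cvg => // [n|].
    rewrite c0 /=; apply: le_lt_trans hp1.
    by rewrite ger_pMr // exprn_ile1 // ltW.
  by rewrite -[0](mulr0 p); apply: cvgM => //; exact: cvg_cst.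
pose z r := r `^ (p * r / (1 - p + p * r)).
(* The choice [s = n ^ 2] is long enough for the coupling and short enough against the exponential
   decay of [z r ^+ n] and [(1 - p) ^+ n]; only [2 * r] remains in the limit. *)
apply: (@near_le_cvg0 _ _ (fun r n => 2 * ((1 - n%:R^-1) ^+ (n ^ 2) * n%:R +
  (r + (n ^ 2)%:R * (r^-1 * z r ^+ n)) + (n ^ 2).+2%:R * (1 - p) ^+ n)) 2) => //.
  move=> r r0 r1; near=> n; apply: cc_scaled_cdf_geometric => //.
  by near: n; exists 1%N.
move=> r r0 r1; have -> : 2 * r = 2 * (0 + (r + 0) + 0) by rewrite add0r !addr0.
apply: cvgM; first exact: cvg_cst.
apply: cvgD.
  apply: cvgD; first exact: cc_mixing_cvg0.
  apply: cvgD; first exact: cvg_cst.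
  have -> : (fun n => (n ^ 2)%:R * (r^-1 * z r ^+ n)) =
      (fun n => r^-1 * (n%:R ^+ 2 * z r ^+ n)).
    by apply/funext => n; rewrite mulrCA natrX.
  rewrite -[0](mulr0 r^-1); apply: cvgM; first exact: cvg_cst.
  apply: sqr_geometric_cvg0; first by rewrite powR_gt0.
  rewrite /z /powR gt_eqF // expR_lt1 pmulr_rlt0 ?ln_lt0 ?r0 //.
  by apply: divr_gt0; [exact: mulr_gt0|apply: addr_gt0 => //; exact: mulr_gt0].
have -> : (fun n => (n ^ 2).+2%:R * (1 - p) ^+ n) =
    (fun n => n%:R ^+ 2 * (1 - p) ^+ n + 2 * (1 - p) ^+ n).
  by apply/funext => n; rewrite -addn2 natrD mulrDl natrX.
rewrite -[0]addr0; apply: cvgD; first exact: sqr_geometric_cvg0.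
by rewrite -[0](mulr0 2); apply: cvgM => //; exact: cvg_cst.
Unshelve. all: by end_near. Qed.
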